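(* Let $\vec r(t)=(x(t),y(t))$, $t_0<t<t_1$, be a simple regular curve of class $C^2$ in $\mathbb{R}^2$. Fix $t\in(t_0,t_1)$ and let $P=(x(t),y(t))$. For sufficiently small $\Delta t>0$ let $Q=Q(\Delta t)=(x(t+\Delta t),y(t+\Delta t))$ be the moving point on the curve near $P$ with parameter $\Delta t$, and put $f_1(\Delta t)=x(t+\Delta t)-x(t)$, $f_2(\Delta t)=y(t+\Delta t)-y(t)$. Then: (i) For $\mathcal{D}_P=|\overrightarrow{PQ}|$, we have $$\frac{d\mathcal{D}_P}{d\Delta t}=\frac{f_1(\Delta t)x'(t+\Delta t)+f_2(\Delta t)y'(t+\Delta t)}{\sqrt{f_1^2(\Delta t)+f_2^2(\Delta t)}},\quad \Delta t>0;\qquad {\mathcal{D}_P'}_+(0)=\sqrt{x'^2(t)+y'^2(t)}.$$ (ii) The rotational speed of $\overrightarrow{PQ}$ with respect to $\Delta t$ is $$\frac{|y'(t+\Delta t)f_1(\Delta t)-f_2(\Delta t)x'(t+\Delta t)|}{f_1^2(\Delta t)+f_2^2(\Delta t)},\quad \Delta t>0;\qquad \frac12\left|\frac{x'(t)y''(t)-x''(t)y'(t)}{x'^2(t)+y'^2(t)}\right|,\quad \Delta t\to0^+.$$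
   Context: Regular means $(x'(t),y'(t))\neq(0,0)$ for all $t$. $\mathcal{D}_P(0)=0$, and ${\mathcal{D}_P'}_+(0)=\lim_{\Delta t\to0^+}\frac{\mathcal{D}_P(\Delta t)-\mathcal{D}_P(0)}{\Delta t}$ is the right derivative at $0$. For $\Delta t>0$ put $\vec e_{\overrightarrow{PQ}}(\Delta t)=\overrightarrow{PQ}/|\overrightarrow{PQ}|$, and $\vec e_{\overrightarrow{PQ}}(0)=\lim_{\Delta t\to 0^+}\vec e_{\overrightarrow{PQ}}(\Delta t)=\frac{(x'(t),y'(t))}{\sqrt{x'^2(t)+y'^2(t)}}$. The rotational speed of $\overrightarrow{PQ}$ with respect to $\Delta t$ is $\left|\frac{d\vec e_{\overrightarrow{PQ}}}{d\Delta t}\right|$ for $\Delta t>0$, and for ''$\Delta t\to0^+$'' it is $\left|\lim_{\Delta t\to0^+}\frac{\vec e_{\overrightarrow{PQ}}(\Delta t)-\vec e_{\overrightarrow{PQ}}(0)}{\Delta t}\right|$. *)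

(* Defs.v *)
From Stdlib Require Import Reals.
From Coquelicot Require Import Coquelicot.
Open Scope R_scope.

(** A plane curve is given by its coordinate functions [x y : R -> R]; only
    their values on the open parameter interval ]t0, t1[ matter, whose ends may
    be infinite.  Vectors of the plane live in Coquelicot's normed module
    [R * R], whose [norm] is the Euclidean one (see [norm_R2]). *)

Definition inside (t0 t1 : Rbar) (s : R) : Prop := Rbar_lt t0 s /\ Rbar_lt s t1.

(** All the orders [k <= n] are needed: [Derive] is total, so [ex_derive_n f n]
    alone does not give the existence of the lower derivatives. *)
Definition class_C (n : nat) (t0 t1 : Rbar) (f : R -> R) : Prop :=
  forall s, inside t0 t1 s ->
    (forall k, (k <= n)%nat -> ex_derive_n f k s) /\ continuous (Derive_n f n) s.

Definition simple_curve (t0 t1 : Rbar) (x y : R -> R) : Prop :=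
  forall s s', inside t0 t1 s -> inside t0 t1 s' ->
    (x s, y s) = (x s', y s') -> s = s'.

Definition regular_curve (t0 t1 : Rbar) (x y : R -> R) : Prop :=
  forall s, inside t0 t1 s -> (Derive x s, Derive y s) <> (0, 0).

Definition increment (f : R -> R) (t h : R) : R := f (t + h) - f t.

Definition vecPQ (x y : R -> R) (t h : R) : R * R :=
  (increment x t h, increment y t h).

Definition distPQ (x y : R -> R) (t h : R) : R := norm (vecPQ x y t h).

Definition unit_vec (v : R * R) : R * R := scal (/ norm v) v.

(** Meaningful for [h <> 0] only: the value at [h = 0] intended by the limit
    is the unit tangent, supplied in [is_rot_speed_right0]. *)
Definition dirPQ (x y : R -> R) (t h : R) : R * R := unit_vec (vecPQ x y t h).

Definition is_right_derive {V : NormedModule R_AbsRing}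
    (f : R -> V) (f0 : V) (l : V) : Prop :=
  filterlim (fun h => scal (/ h) (minus (f h) f0)) (at_right 0) (locally l).

Definition is_rot_speed (x y : R -> R) (t h w : R) : Prop :=
  exists v : R * R, is_derive (dirPQ x y t) h v /\ norm v = w.

Definition is_rot_speed_right0 (x y : R -> R) (t w : R) : Prop :=
  let e0 := unit_vec (Derive x t, Derive y t) in
  filterlim (dirPQ x y t) (at_right 0) (locally e0) /\
  exists v : R * R, is_right_derive (dirPQ x y t) e0 v /\ norm v = w.

Lemma norm_R2 (a b : R) : norm ((a, b) : R * R) = sqrt (a ^ 2 + b ^ 2).
Proof.
  change (sqrt (Rabs a ^ 2 + Rabs b ^ 2) = sqrt (a ^ 2 + b ^ 2)).
  now rewrite !pow2_abs.
Qed.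

(* Main.v *)
(** The difference quotient of a C^2 function, extended by [f' t] at [h = 0],
    is differentiable at [0] with derivative [f'' t / 2].  For [h > 0] the
    direction of the chord is the normalisation of the pair of difference
    quotients, hence extends to a function differentiable at [0]; so one formula
    for the derivative of a normalised vector gives the rotational speed both at
    [h > 0] (applied to the chord) and at [0+] (applied to the quotients). *)

Require Import Defs.
From Stdlib Require Import Reals Lra.
From Coquelicot Require Import Coquelicot.
Open Scope R_scope.

(** * Differentiation in the plane and right derivatives *)

Lemma locally_inside (t0 t1 : Rbar) (s : R) :
  inside t0 t1 s -> locally s (inside t0 t1).
Proof.
  intros Hs.
  exact (open_and _ _ (open_Rbar_gt t0) (open_Rbar_lt t1) s Hs).
Qed.

(** Decomposing the pair along the basis (1, 0), (0, 1) reduces this to the sum and scalar rules. *)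
Lemma is_derive_pair (f g : R -> R) (s l m : R) :
  is_derive f s l -> is_derive g s m ->
  is_derive (fun h => (f h, g h) : R * R) s ((l, m) : R * R).
Proof.
  intros Hf Hg.
  assert (E : forall a b : R,
    plus (scal a ((1, 0) : R * R)) (scal b ((0, 1) : R * R)) = (a, b)).
  { intros a b.
    change ((a * 1 + b * 0, a * 0 + b * 1) = (a, b)).
    f_equal; ring. }
  apply (is_derive_ext
    (fun h => plus (scal (f h) ((1, 0) : R * R)) (scal (g h) ((0, 1) : R * R)))).
  { intros h; apply E. }
  rewrite <- (E l m).
  set (R2 := prod_NormedModule R_AbsRing R_NormedModule R_NormedModule).
  apply (is_derive_plus (V := R2)); now apply (is_derive_scal_l (V := R2)).
Qed.

Lemma is_derive_right {V : NormedModule R_AbsRing} (f : R -> V) (l : V) :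
  is_derive f 0 l -> is_right_derive f (f 0) l.
Proof.
  intros [_ Hd].
  specialize (Hd 0 (fun P H => H)).
  apply filterlim_locally_ball_norm; intros eps.
  (* Differentiability yields a large inequality and the ball a strict one; halving [eps] makes up
     the difference after division by [h]. *)
  assert (He : 0 < eps / 2) by (destruct eps; simpl; lra).
  specialize (Hd (mkposreal _ He)); simpl in Hd.
  unfold at_right, within.
  revert Hd; apply filter_imp; intros h; simpl in h; intros Hh Hpos.
  unfold ball_norm.
  change (norm (minus (minus (f h) (f 0)) (scal (h + - 0) l))
    <= eps / 2 * Rabs (h + - 0)) in Hh.
  rewrite Ropp_0, Rplus_0_r in Hh.
  assert (E : scal (/ h) (scal h l) = l).
  { etransitivity; [exact (scal_assoc (V := V) (/ h : R_AbsRing) h l) | ].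
    change (mult (/ h : R_AbsRing) h) with (/ h * h).
    rewrite Rinv_l by lra; exact (scal_one (V := V) l). }
  rewrite <- E.
  apply Rle_lt_trans with
    (norm (scal (/ h) (minus (minus (f h) (f 0)) (scal h l)))).
  { right; apply f_equal; symmetry.
    exact (scal_minus_distr_l (V := V) (/ h : R_AbsRing) _ _). }
  eapply Rle_lt_trans; [exact (norm_scal (V := V) (/ h : R_AbsRing) _) | ].
  change (abs (/ h)) with (Rabs (/ h)).
  rewrite Rabs_pos_eq by (left; now apply Rinv_0_lt_compat).
  rewrite (Rabs_pos_eq h) in Hh by lra.
  apply Rle_lt_trans with (/ h * (eps / 2 * h)).
  - apply Rmult_le_compat_l; [left; now apply Rinv_0_lt_compat | exact Hh].
  - replace (/ h * (eps / 2 * h)) with (eps / 2) by (field; lra).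
    destruct eps; simpl; lra.
Qed.

Lemma is_right_derive_ext {V : NormedModule R_AbsRing} (f g : R -> V) (f0 l : V) :
  at_right 0 (fun h => f h = g h) ->
  is_right_derive f f0 l -> is_right_derive g f0 l.
Proof.
  intros E; apply filterlim_ext_loc.
  revert E; apply filter_imp; now intros h ->.
Qed.

(** Defined on both sides of 0, so that the two-sided rules of differentiation apply at 0. *)
Definition slope (f : R -> R) (t h : R) : R :=
  if Req_EM_T h 0 then Derive f t else increment f t h / h.

Lemma slope_0 (f : R -> R) (t : R) : slope f t 0 = Derive f t.
Proof. unfold slope; now destruct (Req_EM_T 0 0). Qed.

Lemma slope_neq0 (f : R -> R) (t h : R) :
  h <> 0 -> slope f t h = increment f t h / h.
Proof. unfold slope; now destruct (Req_EM_T h 0). Qed.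

Lemma is_derive_increment (f : R -> R) (t h : R) :
  ex_derive f (t + h) -> is_derive (increment f t) h (Derive f (t + h)).
Proof.
  intros Hf; unfold increment; auto_derive; [exact Hf | ].
  change (fun x : R => f x) with f; ring.
Qed.

(* The mean value theorem is applied to [f (t + s) - f' t * s - d / 2 * s ^ 2],
   whose derivative is o(s). *)
Lemma is_derive_slope (f : R -> R) (t d : R) :
  locally t (ex_derive f) -> is_derive (Derive f) t d ->
  is_derive (slope f t) 0 (d / 2).
Proof.
  intros [r Hr] Hd.
  apply is_derive_Reals; apply is_derive_Reals in Hd.
  intros eps Heps.
  destruct (Hd (eps / 2)) as [del Hdel]; [lra|].
  assert (Hm : 0 < Rmin r del)
    (* [r] keeps [f] differentiable along the segment from [t] to [t + h]; [del] controls the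
       difference quotient of [f'] at [t]. *)
    by (apply Rmin_glb_lt; [apply r | apply del]).
  exists (mkposreal _ Hm); intros h Hh0 Hh; simpl in Hh.
  assert (Hhr : Rabs h < r) by (eapply Rlt_le_trans; [exact Hh | apply Rmin_l]).
  assert (Hhd : Rabs h < del) by (eapply Rlt_le_trans; [exact Hh | apply Rmin_r]).
  assert (Hbetween : forall s, Rmin 0 h <= s <= Rmax 0 h -> Rabs s <= Rabs h).
  { intros s; unfold Rmin, Rmax, Rabs.
    destruct (Rle_dec 0 h), (Rcase_abs s), (Rcase_abs h); lra. }
  set (g := fun s : R => f (t + s) - Derive f t * s - d / 2 * s ^ 2).
  assert (Hg : forall s, Rmin 0 h <= s <= Rmax 0 h ->
    is_derive g s
      (Derive f (t + s) - Derive f t - d * s)).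
  { intros s Hs; apply Hbetween in Hs.
    assert (ex_derive f (t + s)).
    { apply Hr; change (Rabs (t + s + - t) < r).
      replace (t + s + - t) with s by ring; lra. }
    unfold g; auto_derive; [easy | ].
    change (fun x : R => f x) with f; field. }
  destruct (MVT_gen g 0 h
    (fun s => Derive f (t + s) - Derive f t - d * s)) as [c [Hc Hmv]].
  { intros s Hs; apply Hg; lra. }
  { intros s Hs; apply continuity_pt_filterlim.
    apply (ex_derive_continuous (V := R_NormedModule) g).
    eexists; now apply Hg. }
  apply Hbetween in Hc.
  assert (Hbound : Rabs (Derive f (t + c) - Derive f t - d * c) <= eps / 2 * Rabs h).
  { destruct (Req_EM_T c 0) as [-> | Hc0].
    - replace (t + 0) with t by ring.
      replace (Derive f t - Derive f t - d * 0) with 0 by ring.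
      rewrite Rabs_R0; apply Rmult_le_pos; [lra | apply Rabs_pos].
    - specialize (Hdel c Hc0 ltac:(lra)).
      replace (Derive f (t + c) - Derive f t - d * c)
        with (((Derive f (t + c) - Derive f t) / c - d) * c) by (field; lra).
      rewrite Rabs_mult.
      apply Rmult_le_compat; try apply Rabs_pos; lra. }
  rewrite Rplus_0_l, slope_0, slope_neq0 by exact Hh0.
  unfold increment.
  (* The left side is [(g h - g 0) / h ^ 2], and [g h - g 0] is [h] times the derivative of [g] at
     [c]. *)
  replace (((f (t + h) - f t) / h - Derive f t) / h - d / 2)
    with ((Derive f (t + c) - Derive f t - d * c) / h).
  - unfold Rdiv; rewrite Rabs_mult, Rabs_inv.
    assert (0 < Rabs h) by now apply Rabs_pos_lt.
    apply Rle_lt_trans with (eps / 2 * Rabs h * / Rabs h).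
    + apply Rmult_le_compat_r; [left; now apply Rinv_0_lt_compat | exact Hbound].
    + field_simplify; lra.
  - unfold g in Hmv; replace (t + 0) with t in Hmv by ring.
    replace (Derive f (t + c) - Derive f t - d * c)
      with ((f (t + h) - Derive f t * h - d / 2 * h ^ 2
             - (f t - Derive f t * 0 - d / 2 * 0 ^ 2)) / h)
      by (rewrite Hmv; field; lra).
    field; lra.
Qed.

(** * Norm and normalisation of plane vectors *)

Lemma sum_sqr_pos (a b : R) : (a, b) <> (0, 0) -> 0 < a ^ 2 + b ^ 2.
Proof.
  intros H.
  destruct (Req_EM_T a 0) as [-> | Ha]; [ | nra].
  assert (b <> 0) by (intros ->; now apply H).
  nra.
Qed.

Lemma unit_vec_pair (a b : R) :
  unit_vec (a, b) = (a / sqrt (a ^ 2 + b ^ 2), b / sqrt (a ^ 2 + b ^ 2)).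
Proof.
  unfold unit_vec; rewrite norm_R2.
  change ((/ sqrt (a ^ 2 + b ^ 2) * a, / sqrt (a ^ 2 + b ^ 2) * b)
    = (a / sqrt (a ^ 2 + b ^ 2), b / sqrt (a ^ 2 + b ^ 2))).
  now unfold Rdiv; rewrite !(Rmult_comm (/ _)).
Qed.

Lemma unit_vec_scal (k a b : R) :
  0 < k -> unit_vec (k * a, k * b) = unit_vec (a, b).
Proof.
  intros Hk; rewrite !unit_vec_pair.
  replace ((k * a) ^ 2 + (k * b) ^ 2) with (k ^ 2 * (a ^ 2 + b ^ 2)) by ring.
  rewrite sqrt_mult_alt, sqrt_pow2 by nra.
  unfold Rdiv; rewrite Rinv_mult.
  f_equal; rewrite <- !Rmult_assoc; f_equal; field; lra.
Qed.

(** Chain rule away from the singularity of the square root. Applied to the chord it gives the speed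
    of the distance; applied to the slopes, the continuity of their norm at 0. *)
Lemma is_derive_norm (u v : R -> R) (s u' v' : R) :
  is_derive u s u' -> is_derive v s v' -> (u s, v s) <> (0, 0) ->
  is_derive (fun h => norm ((u h, v h) : R * R)) s
    ((u s * u' + v s * v') / sqrt (u s ^ 2 + v s ^ 2)).
Proof.
  intros Hu Hv Hnz; apply sum_sqr_pos in Hnz.
  apply (is_derive_ext (fun h => sqrt (u h ^ 2 + v h ^ 2))).
  { intros h; now rewrite norm_R2. }
  assert (0 < sqrt (u s ^ 2 + v s ^ 2)) by now apply sqrt_lt_R0.
  auto_derive.
  - repeat split; [now exists u' | now exists v' | simpl in Hnz; lra].
  - rewrite (is_derive_unique u s u' Hu : Derive (fun h : R => u h) s = u'),
      (is_derive_unique v s v' Hv : Derive (fun h : R => v h) s = v').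
    simpl in *; field; lra.
Qed.

(* The derivative of [w / |w|] is [w'] projected orthogonally to [w] and divided
   by [|w|], so its length is [|det (w, w')| / |w|^2]. *)
Lemma is_derive_unit_vec (u v : R -> R) (s u' v' : R) :
  is_derive u s u' -> is_derive v s v' -> (u s, v s) <> (0, 0) ->
  exists w : R * R, is_derive (fun h => unit_vec (u h, v h)) s w /\
    norm w = Rabs (u s * v' - u' * v s) / (u s ^ 2 + v s ^ 2).
Proof.
  intros Hu Hv Hnz.
  assert (Hn := is_derive_norm u v s u' v' Hu Hv Hnz).
  apply sum_sqr_pos in Hnz.
  set (q := u s ^ 2 + v s ^ 2) in *.
  assert (Hr : 0 < sqrt q) by now apply sqrt_lt_R0.
  assert (Hrr : sqrt q ^ 2 = q) by (apply pow2_sqrt; lra).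
  set (k := (u s * v' - u' * v s) / (q * sqrt q)).
  assert (Hns : norm ((u s, v s) : R * R) = sqrt q) by apply norm_R2.
  (* The vector (u, v) turned by a right angle, times [k]; its length [sqrt q] cancels one factor of
     the denominator of [k]. *)
  exists (- v s * k, u s * k); split.
  - apply (is_derive_ext (fun h => (u h / norm ((u h, v h) : R * R),
                                    v h / norm ((u h, v h) : R * R)))).
    { intros h; now rewrite unit_vec_pair, norm_R2. }
    (* Both coordinates of the quotient rule have this shape: [p = u] with [z = - v], then [p = v]
       with [z = u]. *)
    assert (Hproj : forall p p' z : R,
      p' * q - p * (u s * u' + v s * v') = z * (u s * v' - u' * v s) ->
      (p' * sqrt q - p * ((u s * u' + v s * v') / sqrt q)) / sqrt q ^ 2 = z * k).
    { intros p p' z Hz; unfold k.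
      transitivity ((p' * sqrt q ^ 2 - p * (u s * u' + v s * v')) / (sqrt q ^ 2 * sqrt q));
        [field; lra | ].
      rewrite Hrr, Hz; field; lra. }
    apply is_derive_pair.
    + evar_last; [apply is_derive_div; [exact Hu | exact Hn | rewrite Hns; lra] | ].
      cbv beta; rewrite Hns; apply Hproj; unfold q; ring.
    + evar_last; [apply is_derive_div; [exact Hv | exact Hn | rewrite Hns; lra] | ].
      cbv beta; rewrite Hns; apply Hproj; unfold q; ring.
  - rewrite norm_R2.
    replace ((- v s * k) ^ 2 + (u s * k) ^ 2) with (k ^ 2 * q) by (unfold q; ring).
    rewrite sqrt_mult_alt by nra.
    rewrite <- Rsqr_pow2, sqrt_Rsqr_abs; unfold k, Rdiv.
    rewrite Rabs_mult, Rabs_inv, Rabs_mult, (Rabs_pos_eq q), (Rabs_pos_eq (sqrt q)) by lra.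
    field; lra.
Qed.

(** * The chord expressed by its slopes *)

Lemma vecPQ_slope (x y : R -> R) (t h : R) :
  h <> 0 -> vecPQ x y t h = (h * slope x t h, h * slope y t h).
Proof.
  intros Hh; unfold vecPQ; rewrite !slope_neq0 by exact Hh.
  f_equal; field; exact Hh.
Qed.

(** Normalising removes the positive factor [h]. A negative [h] would reverse the direction, so the
    right side continues [dirPQ] smoothly through 0 only from the right. *)
Lemma dirPQ_slope (x y : R -> R) (t h : R) :
  0 < h -> dirPQ x y t h = unit_vec (slope x t h, slope y t h).
Proof.
  intros Hh; unfold dirPQ.
  now rewrite vecPQ_slope, unit_vec_scal by (lra || now apply Rgt_not_eq).
Qed.

Lemma distPQ_slope (x y : R -> R) (t h : R) :
  0 < h -> distPQ x y t h = h * norm ((slope x t h, slope y t h) : R * R).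
Proof.
  intros Hh; unfold distPQ; rewrite vecPQ_slope, !norm_R2 by now apply Rgt_not_eq.
  replace ((h * slope x t h) ^ 2 + (h * slope y t h) ^ 2)
    with (h ^ 2 * (slope x t h ^ 2 + slope y t h ^ 2)) by ring.
  now rewrite sqrt_mult_alt, sqrt_pow2 by nra.
Qed.

Lemma at_right_pos (P : R -> Prop) :
  (forall h, 0 < h -> P h) -> at_right 0 P.
Proof. intros H; unfold at_right, within; now apply filter_forall. Qed.

Lemma ex_derive_filterlim_right {V : NormedModule R_AbsRing} (f : R -> V) :
  ex_derive f 0 -> filterlim f (at_right 0) (locally (f 0)).
Proof.
  intros Hf.
  apply (filterlim_filter_le_1 (F := locally 0) (G := at_right 0) f);
    [apply filter_le_within | ].
  exact (ex_derive_continuous f 0 Hf).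
Qed.

Lemma class_C2_is_derive_slope (t0 t1 : Rbar) (f : R -> R) (t : R) :
  class_C 2 t0 t1 f -> inside t0 t1 t ->
  is_derive (slope f t) 0 (Derive_n f 2 t / 2).
Proof.
  intros Hf Ht; apply is_derive_slope.
  - generalize (locally_inside t0 t1 t Ht); apply filter_imp; intros s Hs.
    exact (proj1 (Hf s Hs) 1%nat ltac:(auto)).
  - apply Derive_correct; exact (proj1 (Hf t Ht) 2%nat ltac:(auto)).
Qed.

Theorem proposition2p6 (t0 t1 : Rbar) (x y : R -> R) (t : R)
    (Hsimple : simple_curve t0 t1 x y)
    (Hregular : regular_curve t0 t1 x y)
    (HxC2 : class_C 2 t0 t1 x)
    (HyC2 : class_C 2 t0 t1 y)
    (Ht : inside t0 t1 t) :
  let f1 := increment x t in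
  let f2 := increment y t in
  let x' := Derive x in
  let y' := Derive y in
  let x'' := Derive_n x 2 in
  let y'' := Derive_n y 2 in
  ((forall h : R, 0 < h -> inside t0 t1 (t + h) ->
      is_derive (distPQ x y t) h
        ((f1 h * x' (t + h) + f2 h * y' (t + h)) / sqrt (f1 h ^ 2 + f2 h ^ 2)))
   /\ distPQ x y t 0 = 0
   /\ is_right_derive (distPQ x y t) (distPQ x y t 0)
        (sqrt (x' t ^ 2 + y' t ^ 2)))
  /\
  ((forall h : R, 0 < h -> inside t0 t1 (t + h) ->
      is_rot_speed x y t h
        (Rabs (y' (t + h) * f1 h - f2 h * x' (t + h)) / (f1 h ^ 2 + f2 h ^ 2)))
   /\ is_rot_speed_right0 x y t
        (1 / 2 * Rabs ((x' t * y'' t - x'' t * y' t) / (x' t ^ 2 + y' t ^ 2)))).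
Proof.
  intros f1 f2 x' y' x'' y''.
  assert (Hincr : forall f h, class_C 2 t0 t1 f -> inside t0 t1 (t + h) ->
    is_derive (increment f t) h (Derive f (t + h))).
  { intros f h Hf Hh; apply is_derive_increment.
    exact (proj1 (Hf _ Hh) 1%nat ltac:(auto)). }
  (* Simplicity keeps Q apart from P, so the chord can be normalised; at 0 regularity does the same
     for the slopes. *)
  assert (Hchord : forall h, 0 < h -> inside t0 t1 (t + h) ->
    (f1 h, f2 h) <> (0, 0)).
  { intros h Hpos Hh E; injection E; unfold f1, f2, increment; intros E2 E1.
    enough (t + h = t) by lra.
    apply Hsimple; [easy | easy | f_equal; lra]. }
  assert (Hsx := class_C2_is_derive_slope t0 t1 x t HxC2 Ht).
  assert (Hsy := class_C2_is_derive_slope t0 t1 y t HyC2 Ht).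
  assert (Hs0 : (slope x t 0, slope y t 0) <> (0, 0))
    by (rewrite !slope_0; now apply Hregular).
  split; split.
  - intros h Hpos Hh.
    apply (is_derive_norm f1 f2); auto; now apply Hincr.
  - assert (H0 : distPQ x y t 0 = 0).
    { unfold distPQ, vecPQ, increment; rewrite norm_R2, Rplus_0_r.
      rewrite !Rminus_diag; replace (0 ^ 2 + 0 ^ 2) with 0 by ring; apply sqrt_0. }
    split; [exact H0 | rewrite H0; unfold is_right_derive].
    (* The quotient of the distance by [h] is the norm of the slopes, so its limit is the value of
       that norm at 0. *)
    apply filterlim_ext_loc with
      (fun h => norm ((slope x t h, slope y t h) : R * R)).
    { apply at_right_pos; intros h Hh; rewrite distPQ_slope by exact Hh.
      change (norm ((slope x t h, slope y t h) : R * R) =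
        / h * (h * norm ((slope x t h, slope y t h) : R * R) - 0)).
      field; lra. }
    unfold x', y'; rewrite <- norm_R2, <- !slope_0.
    apply (ex_derive_filterlim_right (V := R_NormedModule)
      (fun h => norm ((slope x t h, slope y t h) : R * R))).
    eexists; exact (is_derive_norm _ _ _ _ _ Hsx Hsy Hs0).
  - intros h Hpos Hh.
    destruct (is_derive_unit_vec f1 f2 h (x' (t + h)) (y' (t + h))) as [w [Hw Nw]];
      [now apply Hincr | now apply Hincr | auto | ].
    exists w; split; [exact Hw | ].
    rewrite Nw; unfold Rdiv; apply (f_equal (fun z => Rabs z * _)); ring.
  - destruct (is_derive_unit_vec _ _ _ _ _ Hsx Hsy Hs0) as [w [Hw Nw]].
    rewrite !slope_0 in Nw.
    assert (E : at_right 0 (fun h =>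
      unit_vec (slope x t h, slope y t h) = dirPQ x y t h)).
    { apply at_right_pos; intros h Hh; now rewrite dirPQ_slope. }
    (* The unit tangent becomes the value at 0 of the normalised slopes; the limit is then
       continuity at 0. *)
    unfold is_rot_speed_right0; rewrite <- !slope_0; split.
    + apply (filterlim_ext_loc _ _ E).
      apply (ex_derive_filterlim_right (fun h => unit_vec (slope x t h, slope y t h))).
      now exists w.
    + exists w; split.
      * apply (is_right_derive_ext _ _ _ _ E).
        now apply (is_derive_right (fun h => unit_vec (slope x t h, slope y t h))).
      * rewrite Nw; unfold x', y', x'', y''.
        assert (Hq := sum_sqr_pos _ _ (Hregular t Ht)).
        rewrite Rabs_div, (Rabs_pos_eq (_ + _)) by lra.
        (* The factor 1/2 comes from the derivatives [x'' / 2] and [y'' / 2] of the slopes, in which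
           the determinant is linear. *)
        replace (Derive x t * (Derive_n y 2 t / 2) - Derive_n x 2 t / 2 * Derive y t)
          with (/ 2 * (Derive x t * Derive_n y 2 t - Derive_n x 2 t * Derive y t)) by field.
        rewrite Rabs_mult, (Rabs_pos_eq (/ 2)) by lra.
        field; lra.
Qed.
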